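(* Let $G$ be a finite simple graph with vertex set $V(G)=\{x_1,\dots,x_n\}$, let $\mathbb{K}$ be a field, and suppose $G$ has a full-vertex $x$. Then $$\operatorname{pdim}\mathbb{K}[\Delta_G]=\max_{1\leq i\leq n}\{\deg_G(x_i)\}=n-1.$$
   Context: A vertex $x\in V(G)$ is a full-vertex if $N_G[x]=V(G)$, i.e. $x$ is adjacent to every other vertex of $G$. $R=\mathbb{K}[x_1,\dots,x_n]$ is the polynomial ring over $\mathbb{K}$ with variables the vertices of $G$; $I(G)=(x_ix_j\mid \{x_i,x_j\}\in E(G))\subseteq R$ is the edge ideal; $\Delta_G$ is the independence complex of $G$ (the simplicial complex of all independent sets), whose Stanley--Reisner ring is $\mathbb{K}[\Delta_G]=R/I(G)$. $\operatorname{pdim}\mathbb{K}[\Delta_G]$ is the projective dimension of $R/I(G)$ as an $R$-module, i.e. the length of its minimal graded free resolution over $R$. $\deg_G(x)$ is the number of neighbours of $x$ in $G$. *)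

(* Defs.v *)
From mathcomp Require Import all_boot all_order all_algebra.
From mathcomp Require Import mpoly.

Set Implicit Arguments.
Unset Strict Implicit.
Unset Printing Implicit Defensive.

Import GRing.Theory.
Local Open Scope ring_scope.

(* A simple graph on the vertices x_1, ..., x_n is a symmetric irreflexive
   relation e on 'I_n; both properties are hypotheses of the results. *)
Section Graphs.
Variables (n : nat) (e : rel 'I_n).

Definition neighbours (x : 'I_n) : {set 'I_n} := [set y | e x y].

Definition closed_neighbourhood (x : 'I_n) : {set 'I_n} := x |: neighbours x.

Definition degree (x : 'I_n) : nat := #|neighbours x|.

Definition full_vertex (x : 'I_n) : Prop :=
  closed_neighbourhood x = [set: 'I_n].

Definition independent (F : {set 'I_n}) : bool :=
  [forall x in F, forall y in F, ~~ e x y].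

Definition independence_complex : {set {set 'I_n}} :=
  [set F | independent F].

End Graphs.

Section Ideals.
Variables (K : fieldType) (n : nat).
Local Notation R := {mpoly K[n]}.

Definition ideal_gen (S : R -> Prop) (f : R) : Prop :=
  exists (r : nat) (q g : 'I_r -> R),
    (forall k, S (g k)) /\ f = \sum_(k < r) q k * g k.

Definition irrelevant_ideal : R -> Prop :=
  ideal_gen (fun g => exists i : 'I_n, g = 'X_i).

Definition edge_ideal (e : rel 'I_n) : R -> Prop :=
  ideal_gen (fun g => exists i j : 'I_n, e i j /\ g = 'X_i * 'X_j).

Definition Stanley_Reisner_ideal (D : {set {set 'I_n}}) : R -> Prop :=
  ideal_gen (fun g => exists F : {set 'I_n},
                        F \notin D /\ g = \prod_(i in F) 'X_i).

(* The degree d is an integer because it arises as a difference of shifts;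
   for d = k%:Z with k : nat this is f \is k.-homog, and for d < 0 it forces
   f = 0. *)
Definition homogeneous (d : int) (f : R) : Prop :=
  forall m, m \in msupp f -> (mdeg m)%:Z = d.

(* Elements of the free module F_i = R^(rk i) are row vectors, and the
   differential F_(i+1) -> F_i is v |-> v *m diff i, so that row j of diff i is
   the image of the j-th basis vector. That vector has degree shift j, i.e.
   F_i is the direct sum of the R(- shift j).
   A graded map F_0 -> R/I lifts to a graded map F_0 -> R; aug is the column of
   the chosen representatives of the images of the basis vectors. *)
Record graded_free_complex := GradedFreeComplex {
  rk : nat -> nat;
  shift : forall i, 'I_(rk i) -> int;
  diff : forall i, 'M[R]_(rk i.+1, rk i);
  aug : 'cV[R]_(rk 0);
  diff_homogeneous : forall i j k,
    homogeneous (shift j - shift k) (diff i j k);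
  aug_homogeneous : forall j, homogeneous (shift j) (aug j 0)
}.

(* Exactness of ... -> F_2 -> F_1 -> F_0 -> R/I -> 0. *)
Definition resolves_quotient (I : R -> Prop) (C : graded_free_complex) : Prop :=
  [/\ forall f : R, exists v : 'rV[R]_(rk C 0), I (f - (v *m aug C) 0 0),
      forall v : 'rV[R]_(rk C 0),
        I ((v *m aug C) 0 0) <-> exists w, v = w *m diff C 0
    & forall i (v : 'rV[R]_(rk C i.+1)),
        v *m diff C i = 0 <-> exists w, v = w *m diff C i.+1].

Definition minimal (C : graded_free_complex) : Prop :=
  forall i j k, irrelevant_ideal (diff C i j k).

Definition minimal_graded_free_resolution
    (I : R -> Prop) (C : graded_free_complex) : Prop :=
  resolves_quotient I C /\ minimal C.

Definition has_length (C : graded_free_complex) (p : nat) : Prop :=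
  rk C p <> 0%N /\ forall i, (p < i)%N -> rk C i = 0%N.

(* pdim (R/I) = p. The minimal graded free resolution is unique only up to
   isomorphism, so its length is specified by a definite description: one
   exists, and every one has length p. *)
Definition pdim_quotient_is (I : R -> Prop) (p : nat) : Prop :=
  (exists C, minimal_graded_free_resolution I C) /\
  (forall C, minimal_graded_free_resolution I C -> has_length C p).

Lemma ideal_gen_sub (S T : R -> Prop) :
  (forall g, S g -> ideal_gen T g) ->
  forall f, ideal_gen S f -> ideal_gen T f.
Proof.
have T0 : ideal_gen T 0.
  by exists 0%N, (fun=> 0), (fun=> 0); split=> [[]//|]; rewrite big_ord0.
have TD f g : ideal_gen T f -> ideal_gen T g -> ideal_gen T (f + g).
  move=> [r [q [h [hT ->]]]] [r' [q' [h' [hT' ->]]]].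
  pose glue (u : 'I_r -> R) (u' : 'I_r' -> R) (k : 'I_(r + r')) :=
    match split k with inl i => u i | inr i => u' i end.
  exists (r + r')%N, (glue q q'), (glue h h'); split.
    by move=> k; rewrite /glue; case: (split k).
  rewrite big_split_ord /=; congr (_ + _); apply: eq_bigr => i _; rewrite /glue.
    by rewrite -[lshift r' i]/(unsplit (inl i)) unsplitK.
  by rewrite -[rshift r i]/(unsplit (inr i)) unsplitK.
have TM a f : ideal_gen T f -> ideal_gen T (a * f).
  move=> [r [q [h [hT ->]]]]; exists r, (fun k => a * q k), h; split=> //.
  by rewrite big_distrr; apply: eq_bigr => k _; rewrite /= mulrA.
move=> ST f [r [q [g [gS ->]]]].
by apply: (big_ind (ideal_gen T)) => // k _; apply/TM/ST/gS.
Qed.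

Lemma ideal_gen_mul (S : R -> Prop) (a g : R) : S g -> ideal_gen S (a * g).
Proof. by exists 1%N, (fun=> a), (fun=> g); rewrite big_ord1. Qed.

Lemma Stanley_Reisner_independence_complex (e : rel 'I_n) :
  irreflexive e ->
  forall f, Stanley_Reisner_ideal (independence_complex e) f <-> edge_ideal e f.
Proof.
move=> e_irr f; split; apply: ideal_gen_sub => {}f.
  move=> [F [+ ->]]; rewrite inE /independent negb_forall_in.
  case/exists_inP=> i iF; rewrite negb_forall_in.
  case/exists_inP=> j jF; rewrite negbK => eij.
  have ji : j != i by apply: contraTneq eij => ->; rewrite e_irr.
  rewrite (bigD1 i) //= (bigD1 j) /= ?jF // mulrA mulrC.
  by apply: ideal_gen_mul; exists i, j.
move=> [i [j [eij ->]]].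
have ij : i != j by apply: contraTneq eij => ->; rewrite e_irr.
rewrite -[_ * _]mul1r; apply: ideal_gen_mul; exists [set i; j]; split.
  rewrite inE /independent negb_forall_in; apply/exists_inP; exists i.
    by rewrite set21.
  rewrite negb_forall_in; apply/exists_inP; exists j; first by rewrite set22.
  by rewrite eij.
by rewrite big_setU1 ?inE //= big_set1.
Qed.

End Ideals.

(* Main.v *)
Require Import Defs.
From mathcomp Require Import mpoly.
From mathcomp Require Import all_boot all_order all_algebra.
From Stdlib Require Import ClassicalEpsilon.

Set Implicit Arguments.
Unset Strict Implicit.
Unset Printing Implicit Defensive.

Import Order.Theory GRing.Theory.

(** Write R for the polynomial ring in the n vertices, I for the edge ideal and
    y for the sum of all the variables.  By Auslander and Buchsbaum, the claim
    is that R/I has depth exactly 1 when n >= 2.  Both halves of this are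
    elementary: y is regular on R/I, because I is the intersection of the
    kernels of the restrictions to independent sets F, and a nonempty F sees y
    as a nonzero polynomial ([sum_vars_regular]); and the full vertex x is a
    socle element of R/(I + yR), because x times any other vertex is an edge
    and x^2 = y x modulo those edges ([socle_element]).

    Depth and Tor are bypassed by following a minimal resolution C through its
    reductions modulo y, then modulo y and one, two, ... further variables,
    until only the residue field is left.  The step from one reduction to the
    next divides by an element that is regular on the ring; exactness is
    preserved in all positions but the lowest one ([exact_mod_step]), and a
    nonzero class killed by the irrelevant ideal moves up from position i to
    position i + 1 by a connecting homomorphism ([socle_class_step]).
    Starting from the regularity of y and from the socle class of x, the n - 1
    steps leave a complex over the field which is exact in positions >= n and
    whose module in position n - 1 is nonzero; as the differentials of a
    minimal complex vanish over the residue field, exactness there means that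
    the modules themselves are zero ([minimal_resolution_length]).

    A minimal graded free resolution also has to be produced.  Submodules of
    R^r are finitely generated: Dickson's lemma gives this for ideals through
    leading monomials, and one coordinate at a time does the rest
    ([submodule_fin_gen]).  For a graded submodule the homogeneous components
    of generators are generators, and as long as some relation between them
    has an entry with a nonzero constant term, one of them can be discarded
    ([minimal_generators]).  Iterating this on syzygy modules gives the
    resolution ([minimal_resolution_exists]). *)

(** * Ideals, substitutions and Stanley-Reisner ideals *)

Section Substitutions.
Local Open Scope ring_scope.
Variables (K : fieldType) (n : nat).
Local Notation R := {mpoly K[n]}.

Definition ideal (J : R -> Prop) : Prop :=
  [/\ J 0, forall f g, J f -> J g -> J (f + g) & forall a f, J f -> J (a * f)].

Lemma ideal_gen_ideal (S : R -> Prop) : ideal (ideal_gen S).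
Proof.
split=> [|f g Sf Sg|a f Sf].
- by exists 0%N, (fun=> 0), (fun=> 0); split=> [[]//|]; rewrite big_ord0.
- apply: (@ideal_gen_sub K n (ideal_gen S)) => //.
  exists 2%N, (fun=> 1), (fun k : 'I_2 => if val k == 0%N then f else g); split.
    by move=> k; case: ifP.
  by rewrite !big_ord_recl big_ord0 /= !mul1r addr0.
- apply: (@ideal_gen_sub K n (ideal_gen S)) => //.
  exact: ideal_gen_mul.
Qed.

Lemma ideal_gen_mem (S : R -> Prop) f : S f -> ideal_gen S f.
Proof. by move=> Sf; rewrite -[f]mul1r; apply: ideal_gen_mul. Qed.

Lemma idealN (J : R -> Prop) f : ideal J -> J f -> J (- f).
Proof. by move=> [_ _ JM] Jf; rewrite -mulN1r; apply: JM. Qed.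

Lemma idealB (J : R -> Prop) f g : ideal J -> J f -> J g -> J (f - g).
Proof. by move=> iJ Jf Jg; have [_ JD _] := iJ; apply: JD => //; apply: idealN. Qed.

Lemma ideal_sum (J : R -> Prop) (I : Type) (r : seq I) (P : pred I) (F : I -> R) :
  ideal J -> (forall i, P i -> J (F i)) -> J (\sum_(i <- r | P i) F i).
Proof. by move=> [J0 JD _]; apply: big_ind. Qed.

(** Modulo J the substitution s fixes the variables, hence all polynomials.  This
    is how kernels of substitutions are computed below: if f vanishes under s,
    then f = f - s(f) lies in J. *)
Lemma ideal_comp_mpoly (J : R -> Prop) (s : n.-tuple R) :
  ideal J -> (forall i, J ('X_i - tnth s i)) -> forall f, J (f - (f \mPo s)).
Proof.
move=> iJ Js; case: (iJ) => J0 JD JM.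
have JX (m : 'X_{1..n}) : J ('X_[m] - ('X_[m] \mPo s)).
  rewrite comp_mpolyX mpolyXE_id.
  pose eqJ (f g : R) := J (f - g).
  have eqJM f g f' g' : eqJ f g -> eqJ f' g' -> eqJ (f * f') (g * g').
    rewrite /eqJ => Jfg Jfg'.
    have -> : f * f' - g * g' = f' * (f - g) + g * (f' - g').
      by rewrite !mulrBr addrA (mulrC f') (mulrC f') addrNK.
    by apply: JD; apply: JM.
  apply: (big_ind2 eqJ) => // [|i _]; first by rewrite /eqJ subrr.
  elim: (m i) => [|k IH]; first by rewrite !expr0 /eqJ subrr.
  by rewrite !exprS; apply: eqJM.
move=> f; rewrite comp_mpolyEX {1}[f]mpolyE -sumrB.
apply: ideal_sum => // m _; rewrite -scalerBr -mul_mpolyC.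
exact: JM.
Qed.

Lemma kernel_ideal (B : nzRingType) (f : {rmorphism R -> B}) :
  ideal (fun a => f a = 0).
Proof.
split=> [|a b a0 b0|a b b0]; first exact: rmorph0.
  by rewrite rmorphD a0 b0 addr0.
by rewrite rmorphM b0 mulr0.
Qed.

Lemma irrelevant_idealP (f : R) : irrelevant_ideal f <-> f.@[fun=> 0] = 0.
Proof.
split=> [[r [q [g [gX ->]]]]|f0].
  rewrite raddf_sum big1 // => k _; have [i ->] := gX k.
  by rewrite /= mevalM mevalXU mulr0.
pose s : n.-tuple R := [tuple 0 | i < n].
have iI : ideal (@irrelevant_ideal K n) by apply: ideal_gen_ideal.
have Is i : irrelevant_ideal ('X_i - tnth s i).
  by rewrite tnth_mktuple subr0; apply: ideal_gen_mem; exists i.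
have := ideal_comp_mpoly iI Is f.
have -> : f \mPo s = 0.
  transitivity (f.@[fun=> 0])%:MP_[n]; last by rewrite f0 mpolyC0.
  rewrite [in RHS]mevalE comp_mpolyE raddf_sum; apply: eq_bigr => m _ /=.
  rewrite mpolyCM mul_mpolyC rmorph_prod; congr (_ *: _).
  by apply: eq_bigr => i _; rewrite rmorphXn tnth_mktuple /= mpolyC0.
by rewrite subr0.
Qed.

Definition restrict_to (F : {set 'I_n}) : n.-tuple R :=
  [tuple if i \in F then 'X_i else 0 | i < n].

Lemma restrict_toX (F : {set 'I_n}) i :
  'X_i \mPo restrict_to F = if i \in F then 'X_i else 0.
Proof. by rewrite comp_mpolyXU -tnth_nth tnth_mktuple. Qed.

Lemma restrict_to_monomial (F : {set 'I_n}) (m : 'X_{1..n}) :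
  'X_[m] \mPo restrict_to F =
  if [set i | m i != 0%N] \subset F then 'X_[m] else 0.
Proof.
rewrite comp_mpolyX; case: ifPn => [/subsetP mF|/subsetPn [i]].
  rewrite [RHS]mpolyXE_id; apply: eq_bigr => i _; rewrite tnth_mktuple.
  case: ifPn => // iF; have: i \notin [set i | m i != 0%N].
    by apply: contra iF; apply: mF.
  by rewrite inE negbK => /eqP ->; rewrite !expr0.
rewrite inE => mi iF; rewrite (bigD1 i) //= tnth_mktuple (negbTE iF).
by rewrite expr0n (negbTE mi) mul0r.
Qed.

Lemma mcoeff_restrict_to (F : {set 'I_n}) (f : R) (m : 'X_{1..n}) :
  [set i | m i != 0%N] \subset F -> (f \mPo restrict_to F)@_m = f@_m.
Proof.
move=> mF; rewrite comp_mpolyEX [in RHS](mpolyE f) !raddf_sum /=.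
apply: eq_bigr => m' _; rewrite restrict_to_monomial !mcoeffZ.
case: ifPn => // m'F; rewrite mcoeff0 mcoeffX; case: eqP => // mm'.
by rewrite mm' mF in m'F.
Qed.

Section StanleyReisner.
Variable D : {set {set 'I_n}}.
Hypothesis D_down : forall F G : {set 'I_n}, F \in D -> G \subset F -> G \in D.

(** The decomposition of a squarefree monomial ideal as the intersection of the
    primes generated by the complements of the faces.  A monomial whose support
    F is not a face is a multiple of the generator attached to F; all the other
    monomials of f are seen by the restriction to their own support. *)
Lemma Stanley_Reisner_idealP (f : R) :
  Stanley_Reisner_ideal D f <->
  forall F, F \in D -> f \mPo restrict_to F = 0.
Proof.
split=> [[r [q [g [gD ->]]]] F FD|f0].
  rewrite raddf_sum big1 // => k _ /=; rewrite rmorphM /=.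
  have [G [GD ->]] := gD k; have : ~~ (G \subset F).
    by apply: contra GD; apply: D_down.
  case/subsetPn=> i iG iF; rewrite rmorph_prod (bigD1 i) //=.
  by rewrite restrict_toX (negbTE iF) mul0r mulr0.
rewrite [f]mpolyE; have iI := ideal_gen_ideal (fun g : R => exists F : {set 'I_n},
                        F \notin D /\ g = \prod_(i in F) 'X_i).
apply: (big_rec (@Stanley_Reisner_ideal K n D)) => [|m g _ Ig].
  by case: iI.
have [_ ID IM] := iI; apply: ID => //.
pose G := [set i | m i != 0%N]; case: (boolP (G \in D)) => GD.
  by rewrite -(mcoeff_restrict_to _ (subxx G)) f0 // mcoeff0 scale0r; case: iI.
rewrite -mul_mpolyC; apply: (IM).
have -> : 'X_[m] = (\prod_(i < n) 'X_i ^+ (m i).-1) * \prod_(i in G) 'X_i :> R.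
  rewrite mpolyXE_id [X in _ * X]big_mkcond -big_split; apply: eq_bigr => i _.
  rewrite /= inE; case: (m i) => [|k] /=; first by rewrite !expr0 mul1r.
  by rewrite exprSr.
by apply: ideal_gen_mul; exists G.
Qed.

(** Restriction to a nonempty face sends the sum of the variables to a nonzero
    polynomial, which can be cancelled.  The empty face only sees the constant
    term of f, and this is also seen by any vertex. *)
Lemma sum_vars_regular (f : R) :
  (0 < n)%N -> (forall i, [set i] \in D) ->
  Stanley_Reisner_ideal D ((\sum_i 'X_i) * f) -> Stanley_Reisner_ideal D f.
Proof.
move=> n0 D1 /Stanley_Reisner_idealP If; apply/Stanley_Reisner_idealP.
have f0 F i : F \in D -> i \in F -> f \mPo restrict_to F = 0.
  move=> FD iF; have /eqP := If F FD; rewrite rmorphM mulf_eq0 => /orP[|/eqP//].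
  move=> /eqP /(congr1 (mcoeff U_(i))); rewrite /= mcoeff_restrict_to.
    rewrite mcoeff0 raddf_sum (bigD1 i) //= mcoeffXU eqxx big1 ?addr0.
      by move/eqP; rewrite oner_eq0.
    by move=> j ji; rewrite mcoeffXU (negbTE ji).
  by apply/subsetP => j; rewrite inE mnm1E; case: (i =P j) => [<- //|_]; rewrite eqxx.
move=> F FD; case: (set_0Vmem F) => [F0|[i iF]]; last exact: f0 FD iF.
(* F is empty: compare with the vertex i0, which sees the constant term *)
pose i0 := Ordinal n0.
apply/mpolyP => m; rewrite mcoeff0.
have fi := f0 [set i0] i0 (D1 i0) (set11 i0).
case: (boolP ([set i | m i != 0%N] \subset F)) => mF.
  rewrite mcoeff_restrict_to // -(@mcoeff_restrict_to [set i0]) ?fi ?mcoeff0 //.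
  by apply: subset_trans mF _; rewrite F0 sub0set.
rewrite comp_mpolyEX raddf_sum big1 // => m' _ /=.
rewrite restrict_to_monomial mcoeffZ.
case: ifPn => m'F; last by rewrite mcoeff0 mulr0.
rewrite mcoeffX; case: eqP => [mm'|]; last by rewrite mulr0.
by rewrite -mm' m'F in mF.
Qed.

End StanleyReisner.
End Substitutions.

(** * Reducing a complex modulo a regular element *)

(** A quotient of the ring is represented by a ring morphism f whose kernel is
    the ideal in question, so that a vector has its entries in the ideal when
    [map_mx f] kills it.  The passage from f to g divides further by x. *)

Section ReductionOfComplexes.
Local Open Scope ring_scope.
Variables (A : comNzRingType) (rk : nat -> nat).
Variable d : forall i, 'M[A]_(rk i.+1, rk i).

Section Kernel.
Variables (B : nzRingType) (f : {rmorphism A -> B}).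

(** Exactness is asked at position i + 1, so that the differentials on both
    sides exist. *)
Definition exact_mod (i : nat) : Prop :=
  forall v : 'rV_(rk i.+1), map_mx f (v *m d i) = 0 ->
  exists w, map_mx f (v - w *m d i.+1) = 0.

Definition boundary_mod (i : nat) (z : 'rV_(rk i)) : Prop :=
  exists w, map_mx f (z - w *m d i) = 0.

(** A nonzero element of the cokernel of [d i], reduced along f, that m kills. *)
Definition socle_class (m : A -> Prop) (i : nat) (z : 'rV_(rk i)) : Prop :=
  ~ boundary_mod z /\ forall a, m a -> boundary_mod (a *: z).

End Kernel.

Variables (B C : nzRingType) (f : {rmorphism A -> B}) (g : {rmorphism A -> C}).
Variable x : A.
Hypothesis x_regular : forall a, f (x * a) = 0 -> f a = 0.
Hypothesis ker_g : forall a, g a = 0 <-> exists b, f (a - x * b) = 0.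
Hypothesis dd : forall i, d i.+1 *m d i = 0.

Lemma mx_regular p q (M : 'M[A]_(p, q)) :
  map_mx f (x *: M) = 0 -> map_mx f M = 0.
Proof.
move/matrixP=> M0; apply/matrixP => i j; have := M0 i j.
by rewrite !mxE => /x_regular.
Qed.

(** The description of the kernel of g holds entry by entry; the finitely many
    quotients by x are collected into one matrix. *)
Lemma map_mx_kernel_step p q (M : 'M[A]_(p, q)) :
  map_mx g M = 0 <-> exists N, map_mx f (M - x *: N) = 0.
Proof.
split=> [/matrixP M0|[N /matrixP N0]].
  have /fin_all_exists [h hP] (u : 'I_p * 'I_q) :
    exists b, f (M u.1 u.2 - x * b) = 0.
    by apply/ker_g; have := M0 u.1 u.2; rewrite !mxE.
  exists (\matrix_(i, j) h (i, j)); apply/matrixP => i j; rewrite !mxE.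
  exact: hP (i, j).
apply/matrixP => i j; rewrite !mxE; apply/ker_g; exists (N i j).
by have := N0 i j; rewrite !mxE.
Qed.

(** If dv = x w modulo ker f, then x dw = 0, so dw = 0 by regularity of x and
    w = du by exactness one step below; now v - x u is a cycle for f, hence a
    boundary, and v is a boundary modulo x. *)
Lemma exact_mod_step i : exact_mod f i -> exact_mod f i.+1 -> exact_mod g i.+1.
Proof.
move=> ex ex1 v /map_mx_kernel_step [w vw].
have : map_mx f (w *m d i) = 0.
  apply: mx_regular; rewrite scalemxAl.
  have := congr1 (mulmx^~ (map_mx f (d i))) vw.
  rewrite mul0mx -map_mxM mulmxBl -mulmxA dd mulmx0 sub0r map_mxN.
  by move/eqP; rewrite oppr_eq0 => /eqP.
case/ex => u wu.
have : map_mx f ((v - x *: u) *m d i.+1) = 0.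
  rewrite mulmxBl -[v *m _](subrK (x *: w)) -addrA map_mxD vw add0r.
  by rewrite -scalemxAl -scalerBr map_mxZ wu scaler0.
case/ex1 => t vut; exists t; apply/map_mx_kernel_step; exists u.
by rewrite addrAC.
Qed.

(** The connecting homomorphism of multiplication by x.  Since x kills the class
    of z, there is w with x z = dw, and w is the new class.  If w were a
    boundary modulo x, then x z = x dv for some v, making z a boundary.  If
    a z = du, then a w - x u is a cycle, hence a boundary by exactness, so a
    kills the class of w modulo x. *)
Lemma socle_class_step (m : A -> Prop) i :
  m x -> exact_mod f i -> (exists z : 'rV_(rk i), socle_class f m z) ->
  exists z : 'rV_(rk i.+1), socle_class g m z.
Proof.
move=> mx ex [z [z_nb mz]]; have [w xzw] := mz x mx.
exists w; split=> [[u /map_mx_kernel_step [v wuv]]|a ma].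
  apply: z_nb; exists v; apply: mx_regular.
  have -> : x *: (z - v *m d i) =
            (x *: z - w *m d i) + (w - u *m d i.+1 - x *: v) *m d i.
    rewrite !mulmxBl -mulmxA dd mulmx0 subr0 addrA -(addrA (x *: z)) addNr addr0.
    by rewrite scalerBr scalemxAl.
  by rewrite map_mxD xzw add0r map_mxM wuv mul0mx.
have [u azu] := mz a ma.
have : map_mx f ((a *: w - x *: u) *m d i) = 0.
  have -> : (a *: w - x *: u) *m d i =
            x *: (a *: z - u *m d i) - a *: (x *: z - w *m d i).
    rewrite mulmxBl -!scalemxAl !scalerBr !scalerA (mulrC x).
    by rewrite opprB [RHS]addrC addrA subrK.
  by rewrite map_mxB !map_mxZ azu xzw !scaler0 subrr.
case/ex => t awt; exists t; apply/map_mx_kernel_step; exists u.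
by rewrite addrAC.
Qed.

End ReductionOfComplexes.

(** * The regular sequence made of the sum of the variables and of variables *)

Section LinearForms.
Local Open Scope ring_scope.
Variables (K : fieldType) (N : nat).
Local Notation R := {mpoly K[N.+1]}.

Definition tail_sum (j : nat) : R := \sum_(k < N.+1 | (j <= k < N)%N) 'X_k.

(** The substitution with kernel generated by the sum of all the variables and
    by the first j of them: these j variables become 0, and the last variable
    is eliminated by means of the sum.  For j = N everything becomes 0. *)
Definition cut (j : nat) : N.+1.-tuple R :=
  [tuple if i == ord_max then - tail_sum j
         else if (i < j)%N then 0 else 'X_i | i < N.+1].

Lemma cutX j (i : 'I_N.+1) : 'X_i \mPo cut j =
  if i == ord_max then - tail_sum j
  else if (i < j)%N then 0 else 'X_i.
Proof. by rewrite comp_mpolyXU -tnth_nth tnth_mktuple. Qed.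

Lemma cut_sum j i : (i <= j)%N ->
  tail_sum i \mPo cut j = tail_sum j.
Proof.
move=> ij; rewrite /tail_sum raddf_sum (bigID (fun k : 'I_N.+1 => (j <= k)%N)) /=.
rewrite [X in _ + X]big1 ?addr0 => [|k /andP[/andP[_ kN] jk]].
  apply: eq_big => k.
    by case: (leqP j k) => jk; rewrite ?andbF ?andbT //= (leq_trans ij jk).
  move=> /andP[/andP[_ kN] jk]; rewrite cutX ltnNge jk /= -val_eqE /=.
  by rewrite (ltn_eqF kN).
by rewrite cutX ltnNge (negbTE jk) -val_eqE /= (ltn_eqF kN).
Qed.

Lemma sum_vars_recr : \sum_(k < N.+1) 'X_k =
  tail_sum 0 + 'X_ord_max.
Proof.
rewrite (bigD1 ord_max) //= addrC; congr (_ + _); apply: eq_bigl => k.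
by rewrite -val_eqE /= ltn_neqAle -ltnS ltn_ord andbT.
Qed.

Lemma ker_cut0 (a : R) :
  a \mPo cut 0 = 0 <-> exists b, a = (\sum_(k < N.+1) 'X_k) * b.
Proof.
split=> [a0|[b ->]]; last first.
  rewrite rmorphM /= sum_vars_recr rmorphD /= cut_sum // cutX eqxx.
  by rewrite subrr mul0r.
pose J (f : R) := exists b, f = (\sum_(k < N.+1) 'X_k) * b.
have iJ : ideal J.
  split=> [|f g [b ->] [c ->]|f g [b ->]]; first by exists 0; rewrite mulr0.
    by exists (b + c); rewrite mulrDr.
  by exists (f * b); rewrite mulrCA.
suff /(ideal_comp_mpoly iJ)/(_ a) : forall i, J ('X_i - tnth (cut 0) i).
  by rewrite a0 subr0.
move=> i; rewrite tnth_mktuple; case: eqP => [->|_].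
  by exists 1; rewrite opprK addrC mulr1 sum_vars_recr.
by exists 0; rewrite ltn0 subrr mulr0.
Qed.

(** Both inclusions come from [ideal_comp_mpoly]: one with the substitution
    [cut j.+1] and the ideal on the right, the other with [cut j] and the kernel
    of [cut j.+1]. *)
Lemma ker_cutS (j : 'I_N.+1) : (j < N)%N -> forall a : R,
  a \mPo cut j.+1 = 0 <-> exists b, (a - 'X_j * b) \mPo cut j = 0.
Proof.
move=> jN a; have sj : tail_sum j = 'X_j + tail_sum j.+1.
  rewrite /tail_sum (bigD1 j) /= ?leqnn ?jN //; congr (_ + _); apply: eq_bigl => k.
  by rewrite -val_eqE /= andbAC [(j < k)%N]ltn_neqAle eq_sym [_ && (j <= k)%N]andbC.
have jmax : (j == ord_max) = false by rewrite -val_eqE /= (ltn_eqF jN).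
have cj : 'X_j \mPo cut j = 'X_j by rewrite cutX jmax ltnn.
split=> [a0|[b]].
  pose J (f : R) := exists b, (f - 'X_j * b) \mPo cut j = 0.
  have iJ : ideal J.
    split=> [|f g [b fb] [c gc]|f g [b gb]].
    - by exists 0; rewrite mulr0 subr0 rmorph0.
    - by exists (b + c); rewrite mulrDr opprD addrACA rmorphD /= fb gc addr0.
    - by exists (f * b); rewrite mulrCA -mulrBr rmorphM /= gb mulr0.
  suff /(ideal_comp_mpoly iJ)/(_ a) : forall i, J ('X_i - tnth (cut j.+1) i).
    by rewrite a0 subr0.
  move=> i; rewrite tnth_mktuple; case: eqP => [->|imax].
    have -> : tail_sum j.+1 = tail_sum j - 'X_j by rewrite sj addrC addKr.
    exists (-1); rewrite opprK mulrN mulr1 opprK -addrA subrK rmorphD /=.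
    by rewrite cutX eqxx cut_sum // addNr.
  case: (ltngtP i j.+1) => [|ij|ij]; first last.
  - by exists 0; rewrite subrr mulr0 subr0 rmorph0.
  - by exists 0; rewrite subrr mulr0 subr0 rmorph0.
  rewrite subr0 ltnS leq_eqVlt => /orP[/eqP/val_inj ->|ij].
    by exists 1; rewrite mulr1 subrr rmorph0.
  exists 0; rewrite mulr0 subr0 cutX ij; by case: eqP.
suff H c : c \mPo cut j = 0 -> c \mPo cut j.+1 = 0.
  move/H; rewrite rmorphB rmorphM /= cutX jmax ltnSn mul0r subr0; exact.
move=> c0; have := @ideal_comp_mpoly _ _ _ (cut j)
  (kernel_ideal (comp_mpoly (cut j.+1) : {rmorphism R -> R})) _ c.
rewrite c0 subr0; apply=> i /=; rewrite tnth_mktuple rmorphB /= cutX.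
case: eqP => imax; first by rewrite rmorphN opprK /= cut_sum // addNr.
case: (ltnP i j) => ij; first by rewrite (ltn_trans ij (ltnSn j)) rmorph0 subr0.
by rewrite cutX; case: eqP => // _; rewrite subrr.
Qed.

Lemma cut_regular (j : 'I_N.+1) : (j < N)%N -> forall a : R,
  ('X_j * a) \mPo cut j = 0 -> a \mPo cut j = 0.
Proof.
move=> jN a /eqP; have jmax : j != ord_max by rewrite -val_eqE /= (ltn_eqF jN).
rewrite rmorphM /= cutX (negbTE jmax) ltnn.
rewrite mulf_eq0 => /orP[/eqP /(congr1 (mcoeff U_(j)))|/eqP //].
by rewrite mcoeffXU eqxx mcoeff0 => /eqP; rewrite oner_eq0.
Qed.

Lemma cut_irrelevant (a : R) : irrelevant_ideal a -> a \mPo cut N = 0.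
Proof.
case=> r [q [g [gX ->]]]; rewrite raddf_sum big1 // => k _ /=.
have [i ->] := gX k; rewrite rmorphM /= cutX /tail_sum big_pred0 => [|l].
  rewrite oppr0; case: eqP => imax; first by rewrite mulr0.
  rewrite ifT ?mulr0 // ltn_neqAle -ltnS ltn_ord andbT.
  by apply/eqP => iN; apply: imax; apply: val_inj.
by rewrite leqNgt andNb.
Qed.

End LinearForms.

(** * The length of a minimal resolution *)

(** The vertex x is isolated in the complex D, as a full vertex of a graph is in
    the independence complex. *)

Section ResolutionLength.
Local Open Scope ring_scope.
Variables (K : fieldType) (N : nat) (D : {set {set 'I_N.+1}}).
Local Notation R := {mpoly K[N.+1]}.
Local Notation I := (@Stanley_Reisner_ideal K N.+1 D).
Local Notation y := (\sum_(k < N.+1) 'X_k : R).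
Local Notation red j := (comp_mpoly (cut K N j) : {rmorphism R -> R}).
Hypothesis D_down : forall F G : {set 'I_N.+1}, F \in D -> G \subset F -> G \in D.
Hypothesis D_vertices : forall i, [set i] \in D.
Variable x : 'I_N.+1.
Hypothesis x_isolated : forall i, i != x -> [set i; x] \notin D.

Let iI : ideal I. Proof. exact: ideal_gen_ideal. Qed.

(** An element outside I + yR that the irrelevant ideal multiplies into I + yR.
    For N > 0 it is the isolated vertex x.  It is not in I + yR: restricting
    x = y b to the vertex x shows that b has constant term 1, restricting it
    to another vertex that b has constant term 0.  For N = 0, where y = x and
    I = 0, it is 1. *)
Lemma socle_element :
  exists2 u : R, forall b, ~ I (u - y * b)
               & forall a, irrelevant_ideal a -> exists b, I (a * u - y * b).
Proof.
have vertex_eq (u b : R) i : I (u - y * b) ->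
    u \mPo restrict_to K [set i] = 'X_i * (b \mPo restrict_to K [set i]).
  move/(Stanley_Reisner_idealP D_down)/(_ _ (D_vertices i))/eqP.
  rewrite rmorphB rmorphM /= subr_eq0 => /eqP ->; congr (_ * _).
  rewrite raddf_sum (bigD1 i) //= restrict_toX set11 big1 ?addr0 // => j ji.
  by rewrite restrict_toX inE (negbTE ji).
suff [u u1 u2] : exists2 u : R, forall b, ~ I (u - y * b)
    & forall i, exists b, I ('X_i * u - y * b).
  exists u => // a [r [q [g [gX ->]]]].
  have /fin_all_exists [h hP] (k : 'I_r) : exists b, I (g k * u - y * b).
    by have [i ->] := gX k; apply: u2.
  exists (\sum_k q k * h k); rewrite mulr_suml mulr_sumr -sumrB.
  apply: ideal_sum => // k _; rewrite -mulrA [y * _]mulrCA -mulrBr.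
  by case: iI => _ _ IM; apply: IM.
have [N0|Npos] := posnP N.
  have all0 (i : 'I_N.+1) : i = x.
    have z (k : 'I_N.+1) : val k = 0%N.
      by apply/eqP; rewrite -leqn0 (leq_trans (leq_ord k)) // N0.
    by apply: val_inj; rewrite /= !z.
  exists 1 => [b /(vertex_eq _ _ x)|i].
    move/(congr1 (meval (fun=> 0))); rewrite rmorph1 mevalM mevalXU mul0r meval1.
    by move/eqP; rewrite oner_eq0.
  exists 1; rewrite !mulr1 (all0 i) (bigD1 x) //= big1 => [|j].
    by rewrite addr0 subrr; case: iI.
  by rewrite (all0 j) eqxx.
exists 'X_x => [b Ib|i].
  have [i ix] : exists i : 'I_N.+1, i != x.
    apply/existsP; apply: contraLR Npos; rewrite negb_exists => /forallP xall.
    rewrite -leqNgt leqn0; have := xall ord_max; have := xall ord0.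
    by rewrite !negbK => /eqP <- /eqP /(congr1 val) /= ->.
  pose c F := (b \mPo restrict_to K F)@_0%MM.
  have cE F : c F = b@_0%MM.
    rewrite /c mcoeff_restrict_to //; apply/subsetP => j.
    by rewrite inE mnm0E eqxx.
  have b0 : b \mPo restrict_to K [set i] = 0.
    have /esym/eqP := vertex_eq _ _ i Ib; rewrite restrict_toX inE.
    rewrite [x == i]eq_sym (negbTE ix) mulf_eq0.
    case/orP => [/eqP /(congr1 (mcoeff U_(i)))|/eqP //].
    by rewrite mcoeffXU eqxx mcoeff0 => /eqP; rewrite oner_eq0.
  have := vertex_eq _ _ x Ib; rewrite restrict_toX set11.
  move/(congr1 (mcoeff (U_(x) + 0)%MM)); rewrite ['X_x * _]mulrC mcoeffMX.
  rewrite addm0 mcoeffXU eqxx -/(c [set x]) cE -(cE [set i]) /c b0 mcoeff0.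
  by move/eqP; rewrite oner_eq0.
have Ix j : j != x -> I ('X_j * 'X_x).
  move=> jx; apply: ideal_gen_mem; exists [set j; x]; split; first exact: x_isolated.
  by rewrite big_setU1 ?big_set1 // inE.
have [->|ix] := eqVneq i x; last first.
  by exists 0; rewrite mulr0 subr0; apply: Ix.
exists 'X_x; rewrite -mulrBl [X in _ - X](bigD1 x) //= opprD addrA subrr add0r.
rewrite -sumrN mulr_suml; apply: ideal_sum => // j jx.
by rewrite mulNr; apply: idealN => //; apply: Ix.
Qed.

Variable C : graded_free_complex K N.+1.
Hypothesis C_res : resolves_quotient I C.

Lemma diff_diff i : diff C i.+1 *m diff C i = 0.
Proof.
have [_ _ ex] := C_res; apply/row_matrixP => k.
rewrite row_mul row0; apply: (proj2 (ex _ _)); exists (delta_mx 0 k).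
by rewrite -rowE.
Qed.

(** The cokernel of the first differential, reduced modulo y, is R/(I + yR). *)
Lemma boundary_aug (z : 'rV[R]_(rk C 0)) :
  boundary_mod (diff C) (red 0) z <->
  exists b, I ((z *m aug C) 0 0 - y * b).
Proof.
have [sur ex0 _] := C_res; have [I0 ID IM] := iI.
have mx_ker : forall p q (M : 'M[R]_(p, q)),
    map_mx (red 0) M = 0 <->
    exists N, map_mx (idfun : {rmorphism R -> R}) (M - y *: N) = 0.
  move=> p q M; apply: map_mx_kernel_step => a; split.
    by move/ker_cut0 => [b ->]; exists b; rewrite /= subrr.
  by case=> b /eqP; rewrite /= subr_eq0 => /eqP ab; apply/ker_cut0; exists b.
split=> [[w /mx_ker [t]]|[b zb]].
  rewrite map_mx_id // => /eqP; rewrite subr_eq0 => /eqP zwt.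
  exists ((t *m aug C) 0 0).
  have -> : (z *m aug C) 0 0 - y * (t *m aug C) 0 0
            = ((w *m diff C 0) *m aug C) 0 0.
    have -> : w *m diff C 0 = z - y *: t by rewrite -zwt opprB addrC subrK.
    by rewrite mulmxBl -scalemxAl !mxE.
  by apply/ex0; exists w.
have [t tb] := sur b.
have : I (((z - y *: t) *m aug C) 0 0).
  have -> : ((z - y *: t) *m aug C) 0 0 = ((z *m aug C) 0 0 - y * b) +
     y * (b - (t *m aug C) 0 0).
    by rewrite mulmxBl -scalemxAl mulrBr addrA subrK !mxE.
  by apply: ID => //; apply: IM.
case/ex0 => w ztw; exists w; apply/mx_ker; exists t.
by rewrite -ztw opprB addrA addrC addrA addNr add0r subrr map_mx0.
Qed.

(** Induction on j by [exact_mod_step], except for position 1 modulo y, where the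
    step below is the augmentation and y has to be regular on R/I: if dv = y w,
    then y aug(w) lies in I, hence so does aug(w), and w is a
    boundary. *)
Lemma exact_mod_cut (j : nat) : (j <= N)%N ->
  forall i, (j <= i)%N -> exact_mod (diff C) (red j) i.
Proof.
have [sur ex0 ex] := C_res; have [I0 ID IM] := iI.
have y0 : y != 0.
  apply/eqP => /(congr1 (mcoeff U_(x))); rewrite raddf_sum (bigD1 x) //= mcoeffXU.
  rewrite eqxx big1 ?addr0 ?mcoeff0 => [/eqP|k kx]; first by rewrite oner_eq0.
  by rewrite mcoeffXU (negbTE kx).
elim: j => [|j IH] jN i ji; last first.
  case: i ji => // i ji; have jN' : (j < N.+1)%N by apply: ltnW.
  apply: (@exact_mod_step _ _ _ _ _ (red j) _ 'X_(Ordinal jN')).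
  - exact: (@cut_regular _ _ (Ordinal jN')).
  - exact: (@ker_cutS _ _ (Ordinal jN')).
  - exact: diff_diff.
  - by apply: IH => //; apply: ltnW.
  - by apply: IH; [apply: ltnW | apply: leqW].
have exid k : exact_mod (diff C) (idfun : {rmorphism R -> R}) k.
  move=> v; rewrite map_mx_id // => /ex [w ->]; exists w.
  by rewrite subrr map_mx0.
have yreg (a : R) : idfun (y * a) = 0 -> idfun a = 0.
  by move/eqP; rewrite /= mulf_eq0 (negbTE y0) => /eqP.
have kery (a : R) : red 0 a = 0 <-> exists b, idfun (a - y * b) = 0.
  split; first by move/ker_cut0 => [b ->]; exists b; rewrite /= subrr.
  by case=> b /eqP; rewrite /= subr_eq0 => /eqP ab; apply/ker_cut0; exists b.
case: i ji => [_|i _]; last first.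
  exact: (@exact_mod_step _ _ _ _ _ idfun _ y yreg kery diff_diff).
move=> v /(map_mx_kernel_step kery) [w]; rewrite map_mx_id // => /eqP.
rewrite subr_eq0 => /eqP vyw.
have : I ((w *m aug C) 0 0).
  apply: (sum_vars_regular D_down) => //.
  have -> : y * (w *m aug C) 0 0 = ((v *m diff C 0) *m aug C) 0 0.
    by rewrite vyw -scalemxAl [RHS]mxE.
  by apply/ex0; exists v.
case/ex0 => u wu; have : (v - y *: u) *m diff C 0 = 0.
  by rewrite mulmxBl -scalemxAl -wu vyw subrr.
case/ex => t vut; exists t; apply/(map_mx_kernel_step kery); exists u.
by rewrite addrAC vut subrr map_mx0.
Qed.

Lemma socle_class_cut (j : nat) : (j <= N)%N ->
  exists z : 'rV[R]_(rk C j),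
    socle_class (diff C) (red j) (@irrelevant_ideal K N.+1) z.
Proof.
elim: j => [_|j IH jN].
  have [u u1 u2] := socle_element; have [[sur _ _] [I0 ID IM]] := (C_res, iI).
  have [z uz] := sur u; exists z; split=> [/boundary_aug [b zb]|a ma].
    apply: (u1 b); rewrite -(subrK ((z *m aug C) 0 0) u) -addrA.
    exact: ID.
  have [b ub] := u2 a ma; apply/boundary_aug; exists b.
  have -> : ((a *: z) *m aug C) 0 0 - y * b =
    (a * u - y * b) - a * (u - (z *m aug C) 0 0).
    rewrite -scalemxAl mxE mulrBr opprB addrC [RHS]addrC addrA subrK.
    by rewrite addrC.
  by apply: idealB => //; apply: IM.
have jN' : (j < N.+1)%N by apply: ltnW.
apply: (@socle_class_step _ _ _ _ _ (red j) _ 'X_(Ordinal jN')).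
- exact: (@cut_regular _ _ (Ordinal jN')).
- exact: (@ker_cutS _ _ (Ordinal jN')).
- exact: diff_diff.
- by apply: ideal_gen_mem; exists (Ordinal jN').
- by apply: exact_mod_cut => //; apply: ltnW.
- exact/IH/ltnW.
Qed.

(** Modulo all the variables the differentials are zero.  Exactness at a position
    above N makes the constant vector 1 vanish, so the rank is 0 there, while
    the socle class that has reached position N is nonzero. *)
Lemma minimal_resolution_length : minimal C -> has_length C N.
Proof.
move=> C_min; split=> [rk0|[//|i] Ni].
  have [z [z_nb _]] := socle_class_cut (leqnn N); apply: z_nb; exists 0.
  apply/matrixP => k l; have := ltn_ord l; by rewrite {2}rk0.
have ex := exact_mod_cut (leqnn N) Ni; apply/eqP; rewrite -leqn0 leqNgt.
have d0 k : map_mx (red N) (diff C k) = 0.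
  by apply/matrixP => p q; rewrite !mxE; apply/cut_irrelevant/C_min.
apply/negP => rk_gt0; have [|w] := ex (const_mx 1).
  by rewrite map_mxM d0 mulmx0.
move/matrixP/(_ 0 (Ordinal rk_gt0)); rewrite map_mxB map_mxM d0 mulmx0 subr0.
rewrite !mxE => h; have /eqP := etrans (esym (comp_mpoly1 _)) h.
by rewrite oner_eq0.
Qed.

End ResolutionLength.

(** * Finite generation of submodules of free modules *)

Section Noetherianity.
Local Open Scope ring_scope.

(** Induction on the size of a set A of coordinates outside of which all elements
    of Q agree.  Given
    m0 in Q, an m in Q that is not above m0 has a coordinate i in A with
    m i < m0 i; there are finitely many such i and values of m i, and each of
    these slices has fewer free coordinates. *)
Lemma dickson n (P : 'X_{1..n} -> Prop) :
  exists s : seq 'X_{1..n}, (forall m, m \in s -> P m) /\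
    forall m, P m -> exists2 m', m' \in s & (m' <= m)%MM.
Proof.
suff H k (A : {set 'I_n}) (Q : 'X_{1..n} -> Prop) : (#|A| < k)%N ->
    (forall m m' i, Q m -> Q m' -> i \notin A -> m i = m' i) ->
    exists s : seq 'X_{1..n}, (forall m, m \in s -> Q m) /\
      forall m, Q m -> exists2 m', m' \in s & (m' <= m)%MM.
  by apply: (H #|[set: 'I_n]|.+1 setT) => // m m' i _ _; rewrite inE.
elim: k A Q => // k IH A Q Ak QA.
case: (classic (exists m, Q m)) => [[m0 Qm0]|Q0]; last first.
  by exists [::]; split=> // m Qm; case: Q0; exists m.
have /fin_all_exists [h hP] (u : 'I_n * 'I_(mdeg m0).+1) :
    exists s : seq 'X_{1..n}, (forall m, m \in s -> Q m) /\
      (u.1 \in A -> forall m, Q m -> m u.1 = u.2 ->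
       exists2 m', m' \in s & (m' <= m)%MM).
  case: u => i c /=; case: (boolP (i \in A)) => iA; last by exists [::].
  have [||s [sQ sP]] := IH (A :\ i) (fun m => Q m /\ m i = c).
  - by move: Ak; rewrite (cardsD1 i) iA add1n ltnS.
  - move=> m m' j [Qm mc] [Qm' mc']; rewrite in_setD1 negb_and negbK.
    by case/orP => [/eqP ->|]; [rewrite mc mc' | apply: QA].
  by exists s; split=> [m /sQ[]//|_ m Qm mc]; apply: sP.
exists (m0 :: flatten [seq h u | u <- enum {: 'I_n * 'I_(mdeg m0).+1}]); split.
  move=> m; rewrite inE => /orP[/eqP -> //|/flattenP [s /mapP [u _ ->]]].
  by case: (hP u) => hQ _; apply: hQ.
move=> m Qm; case: (boolP (m0 <= m)%MM) => [le|].
  by exists m0 => //; apply: mem_head.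
rewrite negb_forall => /existsP [i]; rewrite -ltnNge => mi.
have iA : i \in A by apply: contraLR mi => iA; rewrite (QA m m0 i) // ltnn.
have mb : (m i < (mdeg m0).+1)%N.
  apply: leq_trans (ltnW mi) _; rewrite mdegE (bigD1 i) //=.
  exact: leq_addr.
have [_ hm] := hP (i, Ordinal mb); have [m' m's m'm] := hm iA m Qm erefl.
exists m' => //; rewrite inE; apply/orP; right; apply/flattenP.
by exists (h (i, Ordinal mb)) => //; apply: map_f; rewrite mem_enum.
Qed.

Variables (K : fieldType) (n : nat).
Local Notation R := {mpoly K[n]}.

Lemma mlead_sub_lt (f g : R) :
  mlead f = mlead g -> mleadc f = mleadc g -> f - g != 0 ->
  (mlead (f - g) < mlead f)%O.
Proof.
move=> fg cfg nz; rewrite lt_neqAle; apply/andP; split.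
  apply: contraNneq nz => e; rewrite -mleadc_eq0 e mcoeffB cfg fg subrr.
  exact: eqxx.
apply: le_trans (mleadB_le _ _) _.
by rewrite fg joinxx.
Qed.

(** Dickson's lemma is applied to the leading monomials of J, and each
    step of the division by the chosen elements lowers the leading monomial,
    for a well-founded order. *)
Lemma ideal_fin_gen (J : R -> Prop) : ideal J ->
  exists q (s : 'cV[R]_q), (forall j, J (s j 0)) /\
    forall f, J f -> exists c : 'rV_q, f = (c *m s) 0 0.
Proof.
move=> iJ; have [J0 JD JM] := iJ.
pose Q m (g : R) := [/\ J g, g != 0 & mlead g = m].
have [ms [msQ msP]] := dickson (fun m => exists g, Q m g).
pose G m := epsilon (inhabits 0) (Q m).
have GP m : m \in ms -> Q m (G m) by move=> /msQ; apply: epsilon_spec.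
pose s := \col_(j < size ms) G (nth 0%MM ms j).
exists (size ms), s; split=> [j|f].
  by rewrite mxE; case: (GP (nth 0%MM ms j)) => //; apply: mem_nth.
move: {2}(mlead f) (erefl (mlead f)) => m.
elim/(@ltmwf n): m f => m IH f fm Jf.
have [->|f0] := eqVneq f 0; first by exists 0; rewrite mul0mx mxE.
have [m' m's m'm] : exists2 m', m' \in ms & (m' <= mlead f)%MM.
  by apply: msP; exists f.
have [JG G0 lG] := GP m' m's.
(* [a * G m'] has the same leading term as f *)
pose a : R := (mleadc f / mleadc (G m')) *: 'X_[mlead f - m'].
have cG : mleadc (G m') != 0 by rewrite mleadc_eq0.
have cf : mleadc f != 0 by rewrite mleadc_eq0.
have la : mlead a = (mlead f - m')%MM.
  by rewrite mleadZ ?mleadXm // mulf_neq0 ?invr_neq0.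
have a0 : a != 0.
  by rewrite -mleadc_eq0 mleadcZE mleadXm mcoeffX eqxx mulr1 mulf_neq0 ?invr_neq0.
have lag : mlead (a * G m') = mlead f by rewrite mleadM // la lG submK.
have cag : mleadc (a * G m') = mleadc f.
  rewrite mleadM // mleadcM mleadcZE mleadXm mcoeffX eqxx mulr1.
  by rewrite divfK.
have [j jlt ej] : exists2 j, (j < size ms)%N & nth 0%MM ms j = m'.
  by exists (index m' ms); rewrite ?index_mem ?nth_index.
have [c ec] : exists c : 'rV_(size ms), f - a * G m' = (c *m s) 0 0.
  have [->|h0] := eqVneq (f - a * G m') 0; first by exists 0; rewrite mul0mx mxE.
  apply: IH (mlead (f - a * G m')) _ _ erefl _; last by apply: idealB => //; apply: JM.
  by rewrite -fm; apply: mlead_sub_lt.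
exists (c + a *: delta_mx 0 (Ordinal jlt)).
by rewrite mulmxDl mxE -ec -scalemxAl mxE -rowE !mxE /= ej subrK.
Qed.


Section Submodules.
Variable r : nat.

Definition submodule (M : 'rV[R]_r -> Prop) : Prop :=
  [/\ M 0, forall v w, M v -> M w -> M (v + w) & forall a v, M v -> M (a *: v)].

Lemma submodule_mulmx (M : 'rV[R]_r -> Prop) p (A : 'M[R]_(p, r)) (w : 'rV_p) :
  submodule M -> (forall j, M (row j A)) -> M (w *m A).
Proof.
move=> [M0 MD MZ] MA; rewrite mulmx_sum_row.
by apply: big_ind => // j _; apply: MZ.
Qed.

(** Induction on the number k of the coordinates that may be nonzero: the values
    of the last of them form a finitely generated ideal, and subtracting a
    combination of lifts of its generators reduces k. *)
Lemma submodule_fin_gen (M : 'rV[R]_r -> Prop) : submodule M ->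
  exists p (A : 'M[R]_(p, r)), (forall j, M (row j A)) /\
    forall v, M v -> exists w, v = w *m A.
Proof.
move=> sM; have [M0 MD MZ] := sM.
pose Mk k (v : 'rV[R]_r) := M v /\ forall i : 'I_r, (k <= i)%N -> v 0 i = 0.
suff /(_ r) [p [A [MA gA]]] : forall k, exists p (A : 'M[R]_(p, r)),
    (forall j, Mk k (row j A)) /\ forall v, Mk k v -> exists w, v = w *m A.
  exists p, A; split=> [j|v Mv]; first by case: (MA j).
  by apply: gA; split=> // i; rewrite leqNgt ltn_ord.
elim=> [|k [p [A [MA gA]]]].
  exists 0%N, 0; split=> [[]//|v [_ v0]]; exists 0.
  by rewrite mul0mx; apply/rowP => i; rewrite v0 ?mxE.
case: (ltnP k r) => kr; last first.
  exists p, A; split=> [j|v [Mv v0]].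
    by have [Mj j0] := MA j; split=> // i /ltnW /j0.
  by apply: gA; split=> // i ki; have := leq_trans kr ki; rewrite leqNgt ltn_ord.
pose i0 := Ordinal kr.
have iJ : ideal (fun f => exists2 v, Mk k.+1 v & v 0 i0 = f).
  split=> [|f g [v [Mv v0] <-] [w [Mw w0] <-]|a f [v [Mv v0] <-]].
  - by exists 0; rewrite ?mxE //; split=> // i _; rewrite mxE.
  - exists (v + w); rewrite ?mxE //; split=> [|i ki]; first exact: MD.
    by rewrite mxE v0 ?w0 ?addr0.
  - exists (a *: v); rewrite ?mxE //; split=> [|i ki]; first exact: MZ.
    by rewrite mxE v0 ?mulr0.
have [q [s [Js gs]]] := ideal_fin_gen iJ.
have /fin_all_exists2 [b Mb bs] := Js.
pose B := \matrix_j b j.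
have rB j : row j B = b j by rewrite rowK.
exists (q + p)%N, (col_mx B A); split=> [j|v [Mv v0]].
  case: (split_ordP j) => l ->; first by rewrite rowKu rB.
  by rewrite rowKd; have [MAl l0] := MA l; split=> // i /ltnW /l0.
have [c ec] : exists c : 'rV_q, v 0 i0 = (c *m s) 0 0 by apply: gs; exists v.
have [w ew] : exists w : 'rV_p, v - c *m B = w *m A.
  have MB : M (c *m B) by apply: submodule_mulmx => // j; rewrite rB; case: (Mb j).
  apply: gA; split=> [|i ki].
    by apply: MD => //; rewrite -scaleN1r; apply: MZ.
  move: ki; rewrite mxE [X in _ + X]mxE leq_eqVlt => /orP[/eqP ki|ki].
    have -> : i = i0 by apply: val_inj.
    apply/eqP; rewrite subr_eq0 ec !mxE; apply/eqP; apply: eq_bigr => j _.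
    by rewrite -bs -(rB j) mxE.
  rewrite v0 // mxE big1 ?subr0 // => j _.
  by have [_ b0] := Mb j; rewrite mxE b0 ?mulr0.
by exists (row_mx c w); rewrite mul_row_col -ew addrC subrK.
Qed.

End Submodules.
End Noetherianity.

(** * Graded submodules and minimal generators *)

Section HomogeneousComponents.
Local Open Scope ring_scope.
Variables (K : fieldType) (n : nat).
Local Notation R := {mpoly K[n]}.

(** Degrees are integers, so that the shifts below never need a sign condition:
    components of negative degree are 0. *)
Definition hcomp (d : int) (f : R) : R :=
  \sum_(m <- msupp f | (mdeg m)%:Z == d) f@_m *: 'X_[m].

Lemma mcoeff_hcomp d f m : (hcomp d f)@_m = if (mdeg m)%:Z == d then f@_m else 0.
Proof.
rewrite /hcomp big_mkcond [in RHS](mpolyE f) !(raddf_sum (mcoeff m)) /=.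
case: ifP => md; [apply: eq_bigr | apply: big1] => m' _.
  rewrite mcoeffZ mcoeffX; case: (m' =P m) => [->|mm'].
    by rewrite md mcoeffZ mcoeffX eqxx.
  rewrite mulr0; case: ifP => _; rewrite ?mcoeff0 // mcoeffZ mcoeffX.
  by rewrite (introF eqP mm') mulr0.
case: ifP => m'd; rewrite ?mcoeff0 // mcoeffZ mcoeffX.
by case: (m' =P m) m'd => [->|_ _]; rewrite ?md ?mulr0.
Qed.

Lemma hcompD d f g : hcomp d (f + g) = hcomp d f + hcomp d g.
Proof.
by apply/mpolyP => m; rewrite mcoeffD !mcoeff_hcomp mcoeffD; case: ifP; rewrite ?addr0.
Qed.

Lemma hcomp0 d : hcomp d 0 = 0.
Proof. by apply/mpolyP => m; rewrite mcoeff_hcomp mcoeff0 if_same. Qed.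

Lemma hcompZ d c f : hcomp d (c *: f) = c *: hcomp d f.
Proof.
by apply/mpolyP => m; rewrite mcoeffZ !mcoeff_hcomp mcoeffZ; case: ifP; rewrite ?mulr0.
Qed.

Lemma hcomp_sum d (T : Type) (r : seq T) (F : T -> R) :
  hcomp d (\sum_(i <- r) F i) = \sum_(i <- r) hcomp d (F i).
Proof. by apply: big_morph; [exact: hcompD | exact: hcomp0]. Qed.

Lemma hcompX d m : hcomp d 'X_[m] = if (mdeg m)%:Z == d then 'X_[m] else 0.
Proof.
apply/mpolyP => k; rewrite mcoeff_hcomp [RHS](fun_if (mcoeff k)) mcoeff0 mcoeffX.
by case: (m =P k) => [->|_] //; rewrite !if_same.
Qed.

Lemma hcomp_homogeneous d f : homogeneous d (hcomp d f).
Proof.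
by move=> m; rewrite mcoeff_msupp mcoeff_hcomp; case: ifP => [/eqP|]; rewrite ?eqxx.
Qed.

Lemma hcompM d e f g : homogeneous e g -> hcomp d (f * g) = hcomp (d - e) f * g.
Proof.
move=> ge; rewrite [in LHS](mpolyE f) [in LHS](mpolyE g) mulr_suml hcomp_sum.
rewrite [in RHS](mpolyE f) hcomp_sum mulr_suml; apply: eq_bigr => m _.
rewrite mulr_sumr hcomp_sum [in RHS](mpolyE g) mulr_sumr.
apply: eq_big_seq => m' m'g; rewrite -scalerAl -scalerAr -mpolyXD 3!hcompZ.
rewrite -scalerAl -scalerAr !hcompX mdegD PoszD (ge _ m'g).
have -> : ((mdeg m)%:Z + e == d) = ((mdeg m)%:Z == d - e).
  by rewrite eq_sym -subr_eq eq_sym.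
by case: ifP; rewrite ?mul0r ?mpolyXD.
Qed.

Lemma hcomp_constant f : hcomp 0 f = (f@_0%MM)%:MP_[n].
Proof.
apply/mpolyP => m; rewrite mcoeff_hcomp mcoeffC eqz_nat mdeg_eq0 eq_sym.
by case: eqP => [->|]; rewrite ?mulr1 ?mulr0.
Qed.

Lemma irrelevant_ideal_mcoeff0 (f : R) : irrelevant_ideal f <-> f@_0%MM = 0.
Proof.
suff -> : f@_0%MM = f.@[fun=> 0] by apply: irrelevant_idealP.
rewrite [in LHS](mpolyE f) mevalE raddf_sum; apply: eq_bigr => m _ /=.
rewrite mcoeffZ mcoeffX; congr (_ * _); case: eqP => [->|/eqP m0].
  by rewrite big1 // => i _; rewrite mnm0E expr0.
have [i mi] : exists i, m i != 0%N.
  apply/existsP; apply: contraNT m0; rewrite negb_exists => /forallP mi.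
  by apply/eqP/mnmP => i; have := mi i; rewrite negbK mnm0E => /eqP.
by rewrite (bigD1 i) //= expr0n (negbTE mi) mul0r.
Qed.

Section GradedSubmodules.
Variables (r : nat) (s : 'I_r -> int).

Definition vcomp (d : int) (v : 'rV[R]_r) : 'rV[R]_r :=
  \row_k hcomp (d - s k) (v 0 k).

Definition graded (M : 'rV[R]_r -> Prop) : Prop :=
  forall v d, M v -> M (vcomp d v).

Definition vdegrees (v : 'rV[R]_r) : seq int :=
  flatten [seq [seq (mdeg m)%:Z + s k | m <- msupp (v 0 k)] | k <- enum 'I_r].

Lemma vcomp_sum (L : seq int) (v : 'rV[R]_r) :
  uniq L -> {subset vdegrees v <= L} -> v = \sum_(d <- L) vcomp d v.
Proof.
move=> uL sL; apply/rowP => k; rewrite summxE; apply/mpolyP => m; rewrite raddf_sum.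
under eq_bigr => d _ do rewrite /= mxE mcoeff_hcomp eq_sym subr_eq.
have [vm|vm] := boolP (m \in msupp (v 0 k)); last first.
  by rewrite (memN_msupp_eq0 vm) big1 // => d _; rewrite if_same.
have dL : (mdeg m)%:Z + s k \in L.
  apply: sL; apply/flattenP; exists [seq (mdeg m)%:Z + s k | m <- msupp (v 0 k)].
    by apply: (map_f (fun k => [seq _ | m <- _])); rewrite mem_enum.
  exact: map_f.
by rewrite (bigD1_seq _ dL) //= eqxx big1 ?addr0 // => d /negbTE ->.
Qed.

Definition homogeneous_rows p (t : 'I_p -> int) (A : 'M[R]_(p, r)) : Prop :=
  forall j k, homogeneous (t j - s k) (A j k).

Definition generating_rows (M : 'rV[R]_r -> Prop) p (A : 'M[R]_(p, r)) : Prop :=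
  (forall j, M (row j A)) /\ forall v, M v -> exists w, v = w *m A.

(** The new generators are the homogeneous components of the old ones, indexed
    by pairs of an old generator and a degree in a common finite list L. *)
Lemma homogeneous_generators (M : 'rV[R]_r -> Prop) : submodule M -> graded M ->
  exists p (t : 'I_p -> int) A, homogeneous_rows t A /\ generating_rows M A.
Proof.
move=> sM gM; have [p [A [MA gA]]] := submodule_fin_gen sM.
pose L := undup (flatten [seq vdegrees (row j A) | j <- enum 'I_p]).
have LA j : {subset vdegrees (row j A) <= L}.
  move=> d dA; rewrite mem_undup; apply/flattenP; exists (vdegrees (row j A)) => //.
  by apply: (map_f (fun j => vdegrees (row j A))); rewrite mem_enum.
pose T := ('I_p * 'I_(size L))%type; pose deg (u : T) := nth 0 L u.2.
pose B := \matrix_(k < #|{: T}|) vcomp (deg (enum_val k)) (row (enum_val k).1 A).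
exists #|{: T}|, (fun k => deg (enum_val k)), B; split=> [j k|].
  by rewrite !mxE; apply: hcomp_homogeneous.
split=> [j|v Mv]; first by rewrite rowK; apply/gM/MA.
have [w ->] := gA v Mv; exists (\row_k w 0 (enum_val k).1).
rewrite [RHS]mulmx_sum_row; under eq_bigr => k _ do rewrite rowK mxE.
rewrite -(big_enum_val (fun u : T => w 0 u.1 *: vcomp (deg u) (row u.1 A))) /=.
rewrite mulmx_sum_row [RHS](eq_bigl xpredT) //.
rewrite -(pair_bigA _ (fun (i : 'I_p) (j : 'I_(size L)) =>
  w 0 i *: vcomp (nth 0 L j) (row i A))) /=.
apply: eq_bigr => j _; rewrite -scaler_sumr; congr (_ *: _).
rewrite {1}(vcomp_sum (undup_uniq _) (LA j)) (big_nth 0) big_mkord.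
by [].
Qed.

End GradedSubmodules.

Lemma vcomp_mulmx p r (s : 'I_r -> int) (t : 'I_p -> int) (A : 'M[R]_(p, r)) d w :
  homogeneous_rows s t A -> vcomp s d (w *m A) = vcomp t d w *m A.
Proof.
move=> hA; apply/rowP => k; rewrite !mxE hcomp_sum; apply: eq_bigr => j _.
by rewrite mxE (hcompM _ _ (hA j k)) opprB addrA subrK.
Qed.

Definition minimal_rows r p (A : 'M[R]_(p, r)) : Prop :=
  forall w : 'rV_p, w *m A = 0 -> forall j, irrelevant_ideal (w 0 j).

(** Induction on the number of generators.  Suppose that a relation w has an entry
    j with constant term c nonzero.  Its component w' in the degree of the
    generator j is again a relation, and its entry j is the constant c, so the
    generator j is a combination of the others and can be removed. *)
Lemma minimal_generators r (s : 'I_r -> int) (M : 'rV[R]_r -> Prop) :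
  submodule M -> graded s M ->
  exists p (t : 'I_p -> int) A,
    [/\ homogeneous_rows s t A, generating_rows M A & minimal_rows A].
Proof.
move=> sM gM; have [p [t [A [hA gA]]]] := homogeneous_generators sM gM.
elim: p t A hA gA => [|p IH] t A hA gA.
  by exists 0%N, t, A; split=> // w _ [].
case: (classic (minimal_rows A)) => [mA|]; first by exists p.+1, t, A.
move=> nmA; have [w nw'] := not_all_ex_not _ _ nmA.
have [wA nw] := imply_to_and _ _ nw'; have [j wj] := not_all_ex_not _ _ nw.
pose w' := vcomp t (t j) w; pose c := (w 0 j)@_0%MM.
have c0 : c != 0 by apply/eqP => c0; apply/wj/irrelevant_ideal_mcoeff0.
have w'A : w' *m A = 0.
  rewrite /w' -(vcomp_mulmx _ _ hA) wA.
  by apply/rowP => k; rewrite !mxE hcomp0.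
have w'j : w' 0 j = c%:MP by rewrite mxE subrr hcomp_constant.
apply: (IH (fun k => t (lift j k)) (row' j A)) => [k l|].
  by rewrite mxE; apply: hA.
have [MA genA] := gA; split=> [k|v Mv].
  have -> : row k (row' j A) = row (lift j k) A by apply/rowP => l; rewrite !mxE.
  exact: MA.
have [z ->] := genA v Mv.
pose z' := z - (z 0 j * (c^-1)%:MP) *: w'.
have z'A : z' *m A = z *m A by rewrite mulmxBl -scalemxAl w'A scaler0 subr0.
have z'j : z' 0 j = 0.
  rewrite mxE [X in _ + X]mxE [X in _ - X]mxE w'j -mulrA -mpolyCM.
  by rewrite mulVf // mulr1 subrr.
exists (col' j z'); rewrite -z'A; apply/rowP => l; rewrite !mxE.
rewrite (bigD1_ord j) //= z'j mul0r add0r; apply: eq_bigr => k _.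
by rewrite [X in _ = X * _]mxE [X in _ = _ * X]mxE.
Qed.

(** A free cover of the graded module M.  The entries of its matrix lie in the
    irrelevant ideal because M lies in the irrelevant multiple of R^r; its
    minimality gives the same property to the module of syzygies, from which
    the next cover is built. *)
Record cover r (s : 'I_r -> int) (M : 'rV[R]_r -> Prop) := Cover {
  cover_rank : nat;
  cover_shift : 'I_cover_rank -> int;
  cover_mx : 'M[R]_(cover_rank, r);
  cover_homogeneous : homogeneous_rows s cover_shift cover_mx;
  cover_irrelevant : forall j k, irrelevant_ideal (cover_mx j k);
  cover_minimal : minimal_rows cover_mx;
  cover_image : forall v, M v <-> exists w, v = w *m cover_mx
}.

Lemma make_cover r (s : 'I_r -> int) (M : 'rV[R]_r -> Prop) :
  submodule M -> graded s M ->
  (forall v, M v -> forall k, irrelevant_ideal (v 0 k)) -> cover s M.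
Proof.
move=> sM gM iM.
suff /constructive_indefinite_description [c _] : exists c : cover s M, True by [].
have [p [t [A [hA [MA genA] mA]]]] := minimal_generators sM gM.
have iA j k : irrelevant_ideal (A j k) by have := iM _ (MA j) k; rewrite mxE.
have gA v : M v <-> exists w, v = w *m A.
  by split=> [/genA//|[w ->]]; apply: submodule_mulmx.
by exists (Cover hA iA mA gA).
Qed.

Lemma syzygy_cover r (s : 'I_r -> int) (M : 'rV[R]_r -> Prop) (c : cover s M) :
  cover (@cover_shift _ _ _ c) (fun v => v *m cover_mx c = 0).
Proof.
apply: make_cover; last exact: cover_minimal.
  split=> [|v w v0 w0|a v v0]; first by rewrite mul0mx.
    by rewrite mulmxDl v0 w0 addr0.
  by rewrite -scalemxAl v0 scaler0.
move=> v d v0; rewrite -(vcomp_mulmx _ _ (cover_homogeneous (c := c))) v0.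
by apply/rowP => k; rewrite !mxE hcomp0.
Qed.

(** One step of the resolution together with the submodule that it covers;
    packing the data makes the construction an iteration, whose ranks and
    shifts agree by computation. *)
Record stage := Stage {
  stage_rank : nat;
  stage_shift : 'I_stage_rank -> int;
  stage_sub : 'rV[R]_stage_rank -> Prop;
  stage_cover : cover stage_shift stage_sub
}.

Definition next_stage (S : stage) : stage := Stage (syzygy_cover (stage_cover S)).

Lemma minimal_resolution_exists (J : R -> Prop) :
  ideal J -> (forall d f, J f -> J (hcomp d f)) ->
  (forall f, J f -> irrelevant_ideal f) ->
  exists C, minimal_graded_free_resolution J C.
Proof.
move=> [J0 JD JM] gJ iJ.
pose M (v : 'rV[R]_1) := J (v 0 0).
have c : cover (fun=> 0) M.
  apply: make_cover => [|v d Mv|v Mv k]; last by rewrite ord1; apply: iJ.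
    split=> [|v w Mv Mw|a v Mv]; rewrite /M !mxE //; first exact: JD.
    exact: JM.
  by rewrite /M mxE subr0; apply: gJ.
pose S i := iter i next_stage (Stage c).
have aug_homog (j : 'I_1) :
    homogeneous (stage_shift (s := S 0) j) ((1%:M : 'cV[R]_1) j 0).
  move=> m; rewrite ord1 mxE eqxx msupp1 mem_seq1 => /eqP ->.
  by rewrite mdeg0.
pose C : graded_free_complex K n := @GradedFreeComplex K n
  (fun i => stage_rank (S i)) (fun i => @stage_shift (S i))
  (fun i => cover_mx (stage_cover (S i))) 1%:M
  (fun i => cover_homogeneous (c := stage_cover (S i))) aug_homog.
exists C; split; last by move=> i j k; apply: cover_irrelevant.
split=> [f|v|i v].
- by exists f%:M; rewrite mulmx1 mxE eqxx subrr.
- by rewrite mulmx1; apply: (cover_image c).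
- exact: (cover_image (stage_cover (S i.+1))).
Qed.

End HomogeneousComponents.

(** * Resolutions of Stanley-Reisner rings *)

Section StanleyReisner.
Local Open Scope ring_scope.
Variables (K : fieldType) (n : nat).
Local Notation R := {mpoly K[n]}.

Lemma ideal_gen_hcomp (S : R -> Prop) :
  (forall g, S g -> exists e, homogeneous e g) ->
  forall d f, ideal_gen S f -> ideal_gen S (hcomp d f).
Proof.
move=> hS d f [r [q [g [gS ->]]]].
have /fin_all_exists [e ge] k : exists e, homogeneous e (g k) by apply: hS.
exists r, (fun k => hcomp (d - e k) (q k)), g; split=> //.
by rewrite hcomp_sum; apply: eq_bigr => k _; apply: hcompM.
Qed.

Lemma Stanley_Reisner_resolution (D : {set {set 'I_n}}) :
  (forall F G : {set 'I_n}, F \in D -> G \subset F -> G \in D) -> set0 \in D ->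
  exists C, minimal_graded_free_resolution (@Stanley_Reisner_ideal K n D) C.
Proof.
move=> D_down D0; apply: minimal_resolution_exists => [|d f|f If].
- exact: ideal_gen_ideal.
- apply: ideal_gen_hcomp => g [F [_ ->]].
  exists (mdeg (\sum_(i in F) U_(i))%MM)%:Z => m.
  by rewrite mprodXE msuppX mem_seq1 => /eqP ->.
apply/irrelevant_ideal_mcoeff0; rewrite -(mcoeff_restrict_to (F := set0)).
  by rewrite (proj1 (Stanley_Reisner_idealP D_down f) If _ D0) mcoeff0.
by apply/subsetP => i; rewrite inE mnm0E.
Qed.

End StanleyReisner.

(** * Graphs with a full vertex *)

Section FullVertex.
Variables (n : nat) (e : rel 'I_n).

Lemma independence_complex_down (F G : {set 'I_n}) :
  F \in independence_complex e -> G \subset F -> G \in independence_complex e.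
Proof.
rewrite !inE => /forall_inP indF /subsetP GF.
apply/forall_inP => i iG; apply/forall_inP => j jG.
by have /forall_inP := indF i (GF i iG); apply; apply: GF.
Qed.

Lemma full_vertex_adj (x i : 'I_n) : full_vertex e x -> i != x -> e x i.
Proof.
move=> xfull ix; have := in_setT i; rewrite -xfull !inE.
by rewrite (negbTE ix).
Qed.

Lemma max_degree_full_vertex (x : 'I_n) :
  irreflexive e -> full_vertex e x -> \max_(i < n) degree e i = n.-1.
Proof.
move=> e_irr xfull; have card_le i : degree e i <= n.-1.
  have := cardsC1 i; rewrite card_ord => <-; apply/subset_leq_card/subsetP => j.
  by rewrite !inE; apply: contraTneq => ->; rewrite e_irr.
apply/eqP; rewrite eqn_leq; apply/andP; split; first by apply/bigmax_leqP.
apply: leq_trans (leq_bigmax x); have := cardsC1 x; rewrite card_ord => <-.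
apply/subset_leq_card/subsetP => j; rewrite !inE; exact: full_vertex_adj.
Qed.

End FullVertex.

Theorem theorem5p1 (n : nat) (e : rel 'I_n) (e_sym : symmetric e)
    (e_irr : irreflexive e) (K : fieldType) (x : 'I_n)
    (x_full : full_vertex e x) :
  pdim_quotient_is (@Stanley_Reisner_ideal K n (independence_complex e))
                   (\max_(i < n) degree e i) /\
  \max_(i < n) degree e i = n.-1.
Proof.
have deg := max_degree_full_vertex e_irr x_full; split=> //; rewrite deg.
case: n e e_sym e_irr x x_full {deg} => [|N] e _ e_irr x x_full.
  by case: x {x_full}.
have down := @independence_complex_down _ e; split.
  apply: Stanley_Reisner_resolution => //.
  by rewrite inE; apply/forall_inP => i; rewrite inE.
move=> C [C_res C_min].
apply: (minimal_resolution_length down _ _ C_res C_min (x := x)).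
  move=> i; rewrite inE; apply/forall_inP => j; rewrite inE => /eqP ->.
  by apply/forall_inP => k; rewrite inE => /eqP ->; rewrite e_irr.
move=> i ix; rewrite inE; apply/negP => /forall_inP /(_ x (set22 _ _)).
by move/forall_inP/(_ i (set21 _ _)); rewrite full_vertex_adj.
Qed.
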